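(* For every $k\ge1$ and all $\bm{I}_1,\bm{I}_2,\bm{I}_3,\bm{J}_1,\bm{J}_2,\bm{J}_3\in\{0,1\}^k$, \[\sum_{\bm{K}_1,\bm{K}_2,\bm{K}_3\in\{0,1\}^k}L_y(\bm{K}_3,\bm{K}_2;\bm{J}_3,\bm{J}_2)\,L_x(\bm{I}_3,\bm{K}_1;\bm{K}_3,\bm{J}_1)\,R_{y/x}(\bm{I}_2,\bm{I}_1;\bm{K}_2,\bm{K}_1)=\sum_{\bm{L}_1,\bm{L}_2,\bm{L}_3\in\{0,1\}^k}R_{y/x}(\bm{L}_2,\bm{L}_1;\bm{J}_2,\bm{J}_1)\,L_x(\bm{L}_3,\bm{I}_1;\bm{J}_3,\bm{L}_1)\,L_y(\bm{I}_3,\bm{I}_2;\bm{L}_3,\bm{L}_2).\]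
   Context: For $\bm{I}\in\{0,1\}^k$ write $|\bm{I}|=\sum_m I_m$ and $\bm{I}_{[i,j]}=\sum_{m=i}^j I_m$ (empty sum $0$). The $L$-weights: $L_x(\bm{I},\bm{J};\bm{K},\bm{L})=x^{|\bm{L}|}\prod_{m:L_m=1}t^{\bm{I}_{[m+1,k]}+\bm{J}_{[m+1,k]}}$ if $\bm{I}+\bm{J}=\bm{K}+\bm{L}$ and there is no $i$ with $I_i=J_i=1$, and $0$ otherwise. The $R$-weights, for a parameter $z$ (here $z=y/x$): $R_z(\bm{I},\bm{J};\bm{K},\bm{L})=\prod_{i=1}^k\left(z t^{-\delta_i}\right)^{K_i}\left(1-z t^{-\delta_i}\right)^{(J_i-I_i+L_i-K_i)/2}$ with $\delta_i=\tfrac12\left(\bm{J}_{[i+1,k]}-\bm{I}_{[i+1,k]}+\bm{L}_{[i+1,k]}-\bm{K}_{[i+1,k]}\right)$, whenever $\bm{I}+\bm{J}=\bm{K}+\bm{L}$ and there is no $i$ with $I_i=K_i=1$ and $J_i=L_i=0$; otherwise $R_z(\bm{I},\bm{J};\bm{K},\bm{L})=0$. *)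

(* Defs.v *)
From mathcomp Require Import all_boot all_order all_algebra.

Set Implicit Arguments.
Unset Strict Implicit.
Unset Printing Implicit Defensive.

Import GRing.Theory.
Local Open Scope ring_scope.

Notation bvec k := {ffun 'I_k -> bool}.

(* Coordinates are numbered from 0: index i : 'I_k is the i+1-st coordinate of
   the text. *)
Definition bsize (k : nat) (I : bvec k) : nat := (\sum_(m < k) I m)%N.

(* I_[i+1,k], the sum of the coordinates strictly after i. *)
Definition btail (k : nat) (I : bvec k) (i : 'I_k) : nat :=
  (\sum_(m < k | i < m) I m)%N.

Definition conserved (k : nat) (I J K L : bvec k) : bool :=
  [forall i, (I i + J i == K i + L i)%N].

Definition Lweight (F : fieldType) (t : F) (k : nat) (x : F)
    (I J K L : bvec k) : F :=
  if conserved I J K L && ~~ [exists i, I i && J i]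
  then x ^+ bsize L * \prod_(m < k | L m) t ^+ (btail I m + btail J m)%N
  else 0.

(* The integer divisions by 2 below are exact when I + J = K + L, since then
   J - I + L - K = 2 (J - K); moreover the exponent Rexp is 0 or 1 wherever
   Rweight does not vanish by definition. *)
Definition Rdelta (k : nat) (I J K L : bvec k) (i : 'I_k) : int :=
  (((btail J i)%:Z - (btail I i)%:Z + (btail L i)%:Z - (btail K i)%:Z)
     %/ 2)%Z.

Definition Rexp (k : nat) (I J K L : bvec k) (i : 'I_k) : int :=
  (((J i : nat)%:Z - (I i : nat)%:Z + (L i : nat)%:Z - (K i : nat)%:Z)
     %/ 2)%Z.

Definition Rweight (F : fieldType) (t : F) (k : nat) (z : F)
    (I J K L : bvec k) : F :=
  if conserved I J K L && ~~ [exists i, [&& I i, K i, ~~ J i & ~~ L i]]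
  then \prod_(i < k)
         ((z * t ^ (- Rdelta I J K L i)) ^+ K i *
          (1 - z * t ^ (- Rdelta I J K L i)) ^ Rexp I J K L i)
  else 0.

(* Main.v *)
Require Import Defs.
From mathcomp Require Import all_boot all_order all_algebra.
From mathcomp Require Import ring zify.

(** Induct on [k] by splitting off the first coordinate, whose vertex weights
    depend on the other coordinates only through their sizes.  By conservation
    these weights are rational functions of [u = x t^(|I3| + |K1|)] and
    [v = y t^(|I3| + |I2|)] on the left, and of [u' = x t^(|J3| + |L1|)] and
    [v' = y t^(|J3| + |J2|)] on the right; [v] and [v'] are constant, while [u]
    and [u'] vary with the summation indices.  The identity is strengthened by
    inserting [p_n(u, v)], resp. [p_n(u', v')], into the sums for every [n],
    where [p_n(u, v) = \prod_(j < n) (u - t^-j v)].  Adding a coordinate then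
    replaces [p_n] by the same combination of [p_n] and [p_(n+1)] on both
    sides; [n = 0] is the theorem. *)

Set Implicit Arguments.
Unset Strict Implicit.
Unset Printing Implicit Defensive.

Import GRing.Theory.
Local Open Scope ring_scope.

(** * Splitting off the first coordinate *)

Definition bcons (k : nat) (b : bool) (I : bvec k) : bvec k.+1 :=
  [ffun i => if unlift ord0 i is Some j then I j else b].

Lemma bcons0 k b (I : bvec k) : bcons b I ord0 = b.
Proof. by rewrite ffunE unlift_none. Qed.

Lemma bconsS k b (I : bvec k) i : bcons b I (lift ord0 i) = I i.
Proof. by rewrite ffunE liftK. Qed.

Lemma bcons_surj k (I : bvec k.+1) :
  bcons (I ord0) [ffun i => I (lift ord0 i)] = I.
Proof.
apply/ffunP => i; rewrite ffunE.
by case: unliftP => [j|] ->; rewrite ?ffunE.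
Qed.

Lemma bvec0_eq (I J : bvec 0) : I = J.
Proof. by apply/ffunP => -[]. Qed.

Lemma bsize_bcons k b (I : bvec k) : bsize (bcons b I) = (b + bsize I)%N.
Proof.
rewrite /bsize big_ord_recl bcons0; congr addn.
by apply: eq_bigr => i _; rewrite bconsS.
Qed.

Lemma btail_bcons0 k b (I : bvec k) : btail (bcons b I) ord0 = bsize I.
Proof.
rewrite /btail /bsize big_mkcond big_ord_recl /= add0n.
by apply: eq_bigr => i _; rewrite bconsS.
Qed.

Lemma btail_bconsS k b (I : bvec k) i :
  btail (bcons b I) (lift ord0 i) = btail I i.
Proof.
rewrite /btail big_mkcond big_ord_recl /= add0n [RHS]big_mkcond /=.
by apply: eq_bigr => j _; rewrite bconsS.
Qed.

Lemma forall_ord_recl k (P : pred 'I_k.+1) :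
  [forall i, P i] = P ord0 && [forall i, P (lift ord0 i)].
Proof.
apply/forallP/andP => [H|[P0 /forallP PS] i]; first by split=> //; apply/forallP.
by case: (unliftP ord0 i) => [j|] ->.
Qed.

Lemma conserved_bcons k a b c d (I J K L : bvec k) :
  conserved (bcons a I) (bcons b J) (bcons c K) (bcons d L)
  = (a + b == c + d)%N && conserved I J K L.
Proof.
rewrite /conserved forall_ord_recl !bcons0; congr andb.
by apply: eq_forallb => i; rewrite !bconsS.
Qed.

Lemma conserved_bsize k (I J K L : bvec k) :
  conserved I J K L -> (bsize I + bsize J = bsize K + bsize L)%N.
Proof.
by move=> /forallP H; rewrite /bsize -!big_split; apply: eq_bigr => i _; apply/eqP.
Qed.

Lemma sum_bcons (V : nmodType) k (E : bvec k.+1 -> V) :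
  \sum_I E I = \sum_I \sum_(b : bool) E (bcons b I).
Proof.
rewrite pair_big /= (reindex (fun p => bcons p.2 p.1)) //=.
exists (fun I => ([ffun i => I (lift ord0 i)], I ord0)) => [[I b]|I] _ /=.
  by rewrite bcons0; congr pair; apply/ffunP => i; rewrite ffunE bconsS.
exact: bcons_surj.
Qed.

(** Moves the three bit sums innermost, so that they can be evaluated with the remaining coordinates
    fixed. *)
Lemma sum3_bcons (V : nmodType) k (E : bvec k.+1 -> bvec k.+1 -> bvec k.+1 -> V) :
  \sum_A \sum_B \sum_C E A B C
  = \sum_A \sum_B \sum_C \sum_(a : bool) \sum_(b : bool) \sum_(c : bool)
      E (bcons a A) (bcons b B) (bcons c C).
Proof.
rewrite sum_bcons; apply: eq_bigr => A _.
rewrite (eq_bigr (fun a : bool => \sum_B \sum_C \sum_(b : bool) \sum_(c : bool)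
    E (bcons a A) (bcons b B) (bcons c C))).
  rewrite exchange_big; apply: eq_bigr => B _.
  by rewrite exchange_big.
move=> a _; rewrite sum_bcons; apply: eq_bigr => B _.
by rewrite exchange_big sum_bcons /=; apply: eq_bigr => C _; rewrite exchange_big.
Qed.

(** * Factoring out the weight of the first coordinate *)

(** [w] combines the spectral parameter with the power of [t] contributed by the later
    coordinates. *)
Definition Lvertex (F : fieldType) (w : F) (a b c d : bool) : F :=
  if (a + b == c + d)%N && ~~ (a && b) then w ^+ d else 0.

(** By conservation (b - a + d - c) / 2 = b - c, which is negative only in the excluded
    configuration; this gives the exponent [b && ~~ c]. *)
Definition Rvertex (F : fieldType) (w : F) (a b c d : bool) : F :=
  if (a + b == c + d)%N && ~~ [&& a, c, ~~ b & ~~ d]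
  then w ^+ c * (1 - w) ^+ (b && ~~ c) else 0.

Lemma Lweight_bcons (F : fieldType) (t x : F) k a b c d (I J K L : bvec k) :
  Lweight t x (bcons a I) (bcons b J) (bcons c K) (bcons d L)
  = Lvertex (x * t ^+ (bsize I + bsize J)) a b c d * Lweight t x I J K L.
Proof.
rewrite /Lweight /Lvertex conserved_bcons !negb_exists forall_ord_recl !bcons0.
under eq_forallb do rewrite !bconsS.
rewrite andbACA; case: ifP => [/andP[-> ->]|]; last first.
  by case: ifP => [_ /= ->|]; rewrite ?mulr0 ?mul0r.
rewrite bsize_bcons big_mkcond big_ord_recl bcons0 !btail_bcons0.
under eq_bigr do rewrite bconsS !btail_bconsS.
rewrite -big_mkcond /=.
by case: d; rewrite ?expr1 ?expr0 ?exprS /=; ring.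
Qed.

Lemma Rweight_bcons (F : fieldType) (t z : F) k a b c d (I J K L : bvec k) :
  Rweight t z (bcons a I) (bcons b J) (bcons c K) (bcons d L)
  = Rvertex (z * t ^ ((bsize K)%:Z - (bsize J)%:Z)) a b c d
    * Rweight t z I J K L.
Proof.
rewrite /Rweight /Rvertex conserved_bcons !negb_exists forall_ord_recl !bcons0.
under eq_forallb do rewrite !bconsS.
rewrite andbACA; case: ifP => [/andP[Hv /andP[cons ->]]|]; last first.
  by case: ifP => [_ /= ->|]; rewrite ?mulr0 ?mul0r.
have HI := conserved_bsize cons.
rewrite Hv cons big_ord_recl bcons0; congr (_ * _).
  (* Conservation of sizes gives |L| - |I| = |J| - |K|, so the numerator is 2 (|J| - |K|). *)
  have -> : - Rdelta (bcons a I) (bcons b J) (bcons c K) (bcons d L) ord0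
            = (bsize K)%:Z - (bsize J)%:Z.
    by rewrite /Rdelta !btail_bcons0; lia.
  rewrite /Rexp !bcons0; congr (_ * _).
  by case: a b c d Hv => [] [] [] [].
apply: eq_bigr => i _.
by rewrite /Rdelta /Rexp !btail_bconsS !bconsS.
Qed.

Lemma Lweight_bsize (F : fieldType) (t x : F) k (I J K L : bvec k) :
  Lweight t x I J K L != 0 -> (bsize I + bsize J = bsize K + bsize L)%N.
Proof.
by rewrite /Lweight; case: ifP => [/andP[/conserved_bsize]|]; rewrite ?eqxx.
Qed.

Lemma Rweight_bsize (F : fieldType) (t z : F) k (I J K L : bvec k) :
  Rweight t z I J K L != 0 -> (bsize I + bsize J = bsize K + bsize L)%N.
Proof.
by rewrite /Rweight; case: ifP => [/andP[/conserved_bsize]|]; rewrite ?eqxx.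
Qed.

(** * The products p_n and the sum over one coordinate *)

(** For nonzero [u] this is u^n times the q-Pochhammer symbol (v/u; q)_n with q = t^-1. *)
Definition tpoch (F : fieldType) (t : F) (n : nat) (u v : F) : F :=
  \prod_(j < n) (u - t ^- j * v).

Lemma tpochS (F : fieldType) (t : F) n u v :
  tpoch t n.+1 u v = tpoch t n u v * (u - t ^- n * v).
Proof. by rewrite /tpoch big_ord_recr. Qed.

Lemma tpochZ (F : fieldType) (t : F) n u v :
  tpoch t n (t * u) (t * v) = t ^+ n * tpoch t n u v.
Proof.
rewrite /tpoch -[X in t ^+ X]card_ord -prodr_const -big_split /=.
by apply: eq_bigr => j _; ring.
Qed.

(** Since t u - t^-j v = t (u - t^-(j+1) v), scaling [u] moves every index up by one, and u - v
    supplies the missing index 0. *)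
Lemma tpoch_shift (F : fieldType) (t : F) n u v : t != 0 ->
  (u - v) * tpoch t n (t * u) v = t ^+ n * tpoch t n.+1 u v.
Proof.
move=> t_neq0; elim: n => [|n IH].
  by rewrite tpochS /tpoch !big_ord0 expr0 invr1; ring.
rewrite tpochS mulrA IH [in RHS]tpochS [in RHS]exprS.
by field; rewrite t_neq0 expf_neq0.
Qed.

Lemma tpoch_shift_div (F : fieldType) (t : F) n u v : t != 0 -> u != 0 ->
  (1 - v / u) * tpoch t n (t * u) v = (t ^+ n - v / u) * tpoch t n u v.
Proof.
move=> t_neq0 u_neq0; apply: (mulfI u_neq0).
have -> : u * ((1 - v / u) * tpoch t n (t * u) v) = (u - v) * tpoch t n (t * u) v.
  by field.
by rewrite tpoch_shift // tpochS; field; rewrite u_neq0 expf_neq0.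
Qed.

(* [step0] and [step1] are the coefficients of [p_n] and [p_(n+1)] produced by
   one coordinate with boundary bits [i1], ..., [j3]; they come
   from enumerating the local configurations and do not involve [u] or [u']. *)
Definition step0 (F : fieldType) (t : F) (n : nat) (v v' : F)
    (i1 i2 i3 j1 j2 j3 : bool) : F :=
  if (i1 + i2 + i3 == j1 + j2 + j3)%N then
    match (i1 + i2 + i3)%N with
    | 0 => 1
    | 1 => if j1 then if i1 then 0 else v else t ^+ n * v' ^+ j2
    | 2 => if i1 && j1 then t ^+ n * v * v' ^+ j2 else 0
    | _ => 0
    end
  else 0.

Definition step1 (F : fieldType) (t : F) (n : nat)
    (i1 i2 i3 j1 j2 j3 : bool) : F :=
  if [&& i1 + i2 + i3 == 1, j1 + j2 + j3 == 1 & j1]%N then t ^+ n else 0.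

(** In a nonvanishing term either k1 = i2, and p_n is rescaled by homogeneity, or k1 = 1 and i2 = i3
    = 0. In the latter case [Rvertex] supplies exactly the factor 1 - v/u that undoes the scaling of
    [u] alone. *)
Lemma step_left (F : fieldType) (t : F) n u v v' i1 i2 i3 j1 j2 j3 :
  t != 0 -> u != 0 ->
  \sum_(k1 : bool) \sum_(k2 : bool) \sum_(k3 : bool)
    Lvertex v' k3 k2 j3 j2 * Lvertex u i3 k1 k3 j1
      * Rvertex (v / u) i2 i1 k2 k1
      * tpoch t n (t ^+ (i3 + k1) * u) (t ^+ (i3 + i2) * v)
  = step0 t n v v' i1 i2 i3 j1 j2 j3 * tpoch t n u v
    + step1 t n i1 i2 i3 j1 j2 j3 * tpoch t n.+1 u v.
Proof.
move=> t_neq0 u_neq0; rewrite !big_bool /step0 /step1 /Lvertex /Rvertex.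
have tn_neq0 : t ^+ n != 0 by rewrite expf_neq0.
have shift := tpoch_shift_div n v t_neq0 u_neq0.
case: i1 i2 i3 j1 j2 j3 => [] [] [] [] [] [] /=;
  rewrite ?(mul0r, mulr0, add0r, addr0) //;
  rewrite ?addn0 ?add0n ?expr0 ?expr1 ?mulr1 ?mul1r ?tpochZ // ?tpochS;
  rewrite -?mulrA ?shift;
  by field; rewrite ?u_neq0 ?tn_neq0.
Qed.

Lemma step_right (F : fieldType) (t : F) n u v v' i1 i2 i3 j1 j2 j3 :
  t != 0 -> u != 0 ->
  \sum_(l1 : bool) \sum_(l2 : bool) \sum_(l3 : bool)
    Rvertex (v' / u) l2 l1 j2 j1 * Lvertex u l3 i1 j3 l1
      * Lvertex v i3 i2 l3 l2
      * tpoch t n (t ^+ (j3 + l1) * u) (t ^+ (j3 + j2) * v')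
  = step0 t n v v' i1 i2 i3 j1 j2 j3 * tpoch t n u v'
    + step1 t n i1 i2 i3 j1 j2 j3 * tpoch t n.+1 u v'.
Proof.
move=> t_neq0 u_neq0; rewrite !big_bool /step0 /step1 /Lvertex /Rvertex.
have tn_neq0 : t ^+ n != 0 by rewrite expf_neq0.
have shift := tpoch_shift_div n v' t_neq0 u_neq0.
(* Scaling of [u] alone now forces l1 = 1, so [Lvertex u] puts a factor [u] between 1 - v'/u and
   p_n. *)
have shiftu : (1 - v' / u) * (u * tpoch t n (t * u) v')
            = (t ^+ n - v' / u) * (u * tpoch t n u v').
  by rewrite mulrCA shift; ring.
case: i1 i2 i3 j1 j2 j3 => [] [] [] [] [] [] /=;
  rewrite ?(mul0r, mulr0, add0r, addr0) //;
  rewrite ?addn0 ?add0n ?expr0 ?expr1 ?mulr1 ?mul1r ?tpochZ // ?tpochS;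
  rewrite -?mulrA ?shiftu ?shift;
  by field; rewrite ?u_neq0 ?tn_neq0.
Qed.

(** * Induction on the number of coordinates *)

(** Where the weights of the remaining coordinates do not vanish, conservation turns the three
    vertex parameters into [v'], [u] and [v / u], and [step_left] applies; elsewhere both sides are
    0. *)
Lemma Lsum_bcons (F : fieldType) (x y t : F) n k
    (I1 I2 I3 J1 J2 J3 K1 K2 K3 : bvec k) i1 i2 i3 j1 j2 j3 :
  x != 0 -> t != 0 ->
  let u := x * t ^+ (bsize I3 + bsize K1) in
  let v := y * t ^+ (bsize I3 + bsize I2) in
  let v' := y * t ^+ (bsize J3 + bsize J2) in
  \sum_(k1 : bool) \sum_(k2 : bool) \sum_(k3 : bool)
    Lweight t y (bcons k3 K3) (bcons k2 K2) (bcons j3 J3) (bcons j2 J2)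
      * Lweight t x (bcons i3 I3) (bcons k1 K1) (bcons k3 K3) (bcons j1 J1)
      * Rweight t (y / x) (bcons i2 I2) (bcons i1 I1) (bcons k2 K2) (bcons k1 K1)
      * tpoch t n (x * t ^+ (bsize (bcons i3 I3) + bsize (bcons k1 K1)))
                  (y * t ^+ (bsize (bcons i3 I3) + bsize (bcons i2 I2)))
  = Lweight t y K3 K2 J3 J2 * Lweight t x I3 K1 K3 J1
      * Rweight t (y / x) I2 I1 K2 K1
      * (step0 t n v v' i1 i2 i3 j1 j2 j3 * tpoch t n u v
         + step1 t n i1 i2 i3 j1 j2 j3 * tpoch t n.+1 u v).
Proof.
move=> x_neq0 t_neq0 u v v'.
have u_neq0 : u != 0 by rewrite mulf_neq0 ?expf_neq0.
rewrite -step_left //.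
rewrite mulr_sumr; apply: eq_bigr => k1 _.
rewrite mulr_sumr; apply: eq_bigr => k2 _.
rewrite mulr_sumr; apply: eq_bigr => k3 _.
rewrite !Lweight_bcons Rweight_bcons !bsize_bcons.
have -> : x * t ^+ (i3 + bsize I3 + (k1 + bsize K1)) = t ^+ (i3 + k1) * u.
  by rewrite /u addnACA exprD; ring.
have -> : y * t ^+ (i3 + bsize I3 + (i2 + bsize I2)) = t ^+ (i3 + i2) * v.
  by rewrite /v addnACA exprD; ring.
have [->|/Lweight_bsize Ly] := eqVneq (Lweight t y K3 K2 J3 J2) 0; first by ring.
have [->|/Rweight_bsize R12] := eqVneq (Rweight t (y / x) I2 I1 K2 K1) 0.
  by ring.
rewrite Ly -/u -/v'.
suff -> : y / x * t ^ ((bsize K2)%:Z - (bsize I1)%:Z) = v / u by ring.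
(* This is the exponent of [t] in [v / u], where |I3| cancels. *)
have -> : (bsize K2)%:Z - (bsize I1)%:Z = (bsize I2)%:Z - (bsize K1)%:Z by lia.
rewrite expfzDr // -exprnN -exprnP /u /v !exprD.
by field; rewrite x_neq0 !expf_neq0.
Qed.

(** Here only the parameter of the middle factor needs conservation: |L3| + |I1| = |J3| + |L1|. *)
Lemma Rsum_bcons (F : fieldType) (x y t : F) n k
    (I1 I2 I3 J1 J2 J3 L1 L2 L3 : bvec k) i1 i2 i3 j1 j2 j3 :
  x != 0 -> t != 0 ->
  let u := x * t ^+ (bsize J3 + bsize L1) in
  let v := y * t ^+ (bsize I3 + bsize I2) in
  let v' := y * t ^+ (bsize J3 + bsize J2) in
  \sum_(l1 : bool) \sum_(l2 : bool) \sum_(l3 : bool)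
    Rweight t (y / x) (bcons l2 L2) (bcons l1 L1) (bcons j2 J2) (bcons j1 J1)
      * Lweight t x (bcons l3 L3) (bcons i1 I1) (bcons j3 J3) (bcons l1 L1)
      * Lweight t y (bcons i3 I3) (bcons i2 I2) (bcons l3 L3) (bcons l2 L2)
      * tpoch t n (x * t ^+ (bsize (bcons j3 J3) + bsize (bcons l1 L1)))
                  (y * t ^+ (bsize (bcons j3 J3) + bsize (bcons j2 J2)))
  = Rweight t (y / x) L2 L1 J2 J1 * Lweight t x L3 I1 J3 L1
      * Lweight t y I3 I2 L3 L2
      * (step0 t n v v' i1 i2 i3 j1 j2 j3 * tpoch t n u v'
         + step1 t n i1 i2 i3 j1 j2 j3 * tpoch t n.+1 u v').
Proof.
move=> x_neq0 t_neq0 u v v'.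
have u_neq0 : u != 0 by rewrite mulf_neq0 ?expf_neq0.
rewrite -step_right //.
rewrite mulr_sumr; apply: eq_bigr => l1 _.
rewrite mulr_sumr; apply: eq_bigr => l2 _.
rewrite mulr_sumr; apply: eq_bigr => l3 _.
rewrite !Lweight_bcons Rweight_bcons !bsize_bcons.
have -> : x * t ^+ (j3 + bsize J3 + (l1 + bsize L1)) = t ^+ (j3 + l1) * u.
  by rewrite /u addnACA exprD; ring.
have -> : y * t ^+ (j3 + bsize J3 + (j2 + bsize J2)) = t ^+ (j3 + j2) * v'.
  by rewrite /v' addnACA exprD; ring.
have [->|/Lweight_bsize Lx] := eqVneq (Lweight t x L3 I1 J3 L1) 0; first by ring.
rewrite Lx -/u -/v.
suff -> : y / x * t ^ ((bsize J2)%:Z - (bsize L1)%:Z) = v' / u by ring.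
rewrite expfzDr // -exprnN -exprnP /u /v' !exprD.
by field; rewrite x_neq0 !expf_neq0.
Qed.

Lemma sum_tpoch_eq (F : fieldType) (x y t : F) n k (I1 I2 I3 J1 J2 J3 : bvec k) :
  x != 0 -> t != 0 ->
  \sum_(K1 : bvec k) \sum_(K2 : bvec k) \sum_(K3 : bvec k)
      Lweight t y K3 K2 J3 J2 * Lweight t x I3 K1 K3 J1
        * Rweight t (y / x) I2 I1 K2 K1
        * tpoch t n (x * t ^+ (bsize I3 + bsize K1)) (y * t ^+ (bsize I3 + bsize I2))
  = \sum_(L1 : bvec k) \sum_(L2 : bvec k) \sum_(L3 : bvec k)
      Rweight t (y / x) L2 L1 J2 J1 * Lweight t x L3 I1 J3 L1
        * Lweight t y I3 I2 L3 L2
        * tpoch t n (x * t ^+ (bsize J3 + bsize L1)) (y * t ^+ (bsize J3 + bsize J2)).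
Proof.
move=> x_neq0 t_neq0.
(* [n] stays general because the step uses the hypothesis at both [n] and [n.+1]. *)
elim: k => [|k IH] in n I1 I2 I3 J1 J2 J3 *.
  apply: eq_bigr => K1 _; apply: eq_bigr => K2 _; apply: eq_bigr => K3 _.
  rewrite (bvec0_eq K2 K1) (bvec0_eq K3 K1).
  rewrite (bvec0_eq I1 K1) (bvec0_eq I2 K1) (bvec0_eq I3 K1).
  by rewrite (bvec0_eq J1 K1) (bvec0_eq J2 K1) (bvec0_eq J3 K1); ring.
rewrite -(bcons_surj I1) -(bcons_surj I2) -(bcons_surj I3).
rewrite -(bcons_surj J1) -(bcons_surj J2) -(bcons_surj J3) !sum3_bcons.
under eq_bigr do under eq_bigr do under eq_bigr do
  rewrite Lsum_bcons // mulrDr mulrCA (mulrCA _ (step1 _ _ _ _ _ _ _ _)).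
under [RHS]eq_bigr do under eq_bigr do under eq_bigr do
  rewrite Rsum_bcons // mulrDr mulrCA (mulrCA _ (step1 _ _ _ _ _ _ _ _)).
(* The coefficients [step0] and [step1] depend only on boundary data and coincide on the two sides,
   so they are pulled out of all three sums. *)
under eq_bigr do under eq_bigr do rewrite big_split -!mulr_sumr.
under eq_bigr do rewrite big_split -!mulr_sumr.
under [RHS]eq_bigr do under eq_bigr do rewrite big_split -!mulr_sumr.
under [RHS]eq_bigr do rewrite big_split -!mulr_sumr.
by rewrite !big_split -!mulr_sumr !IH.
Qed.

Theorem theorem4p1 (F : fieldType) (x y t : F) (hx : x != 0) (ht : t != 0)
    (k : nat) (hk : (1 <= k)%N) (I1 I2 I3 J1 J2 J3 : {ffun 'I_k -> bool}) :
  \sum_(K1 : {ffun 'I_k -> bool}) \sum_(K2 : {ffun 'I_k -> bool})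
    \sum_(K3 : {ffun 'I_k -> bool})
      Lweight t y K3 K2 J3 J2 * Lweight t x I3 K1 K3 J1
        * Rweight t (y / x) I2 I1 K2 K1
  = \sum_(L1 : {ffun 'I_k -> bool}) \sum_(L2 : {ffun 'I_k -> bool})
    \sum_(L3 : {ffun 'I_k -> bool})
      Rweight t (y / x) L2 L1 J2 J1 * Lweight t x L3 I1 J3 L1
        * Lweight t y I3 I2 L3 L2.
Proof.
have := sum_tpoch_eq y 0 I1 I2 I3 J1 J2 J3 hx ht.
have tpoch0 u v : tpoch t 0 u v = 1 by rewrite /tpoch big_ord0.
under eq_bigr do under eq_bigr do under eq_bigr do rewrite tpoch0 mulr1.
by under [RHS]eq_bigr do under eq_bigr do under eq_bigr do rewrite tpoch0 mulr1.
Qed.
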